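(* Let $1\leq r\leq\min(m,n)$. Suppose $f\colon\mathbb{R}^{m\times n}\to\mathbb{R}$ is twice continuously differentiable and has $L_f$-Lipschitz continuous gradient. Suppose $(L,R)\in\mathbb{R}^{m\times r}\times\mathbb{R}^{n\times r}$ is an $(\epsilon_1,\epsilon_2)$-approximate 2-critical point for $g(L,R)=f(LR^\top)$ satisfying $L^\top L=R^\top R$, and let $X=LR^\top$ be the corresponding point in $\mathbb{R}^{m\times n}_{\leq r}=\{X\in\mathbb{R}^{m\times n}:\operatorname{rank}X\leq r\}$. Then $$\|\nabla f(X)\|_{\mathrm{op}}\leq\epsilon_2+2L_f\sigma_r(X),$$ where $\|\cdot\|_{\mathrm{op}}$ denotes the largest singular value of a matrix. Moreover, $$\|\operatorname{Proj}_{\mathrm{T}_X\mathbb{R}^{m\times n}_{\leq r}}(-\nabla f(X))\|\leq\min\left\{\sqrt{\frac{2}{\sigma_r(X)}}\,\epsilon_1,\ \sqrt{\operatorname{rank}(\nabla f(X))}\,(\epsilon_2+2L_f\sigma_r(X))\right\},$$ where $\epsilon_1/\sqrt{\sigma_r(X)}$ is interpreted as $+\infty$ if $\operatorname{rank}(X)<r$ (even if $\epsilon_1=0$).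
   Context: $\mathbb{R}^{m\times n}$ has inner product $\langle A,B\rangle=\operatorname{Tr}(A^\top B)$ and Frobenius norm $\|\cdot\|$; $\mathbb{R}^{m\times r}\times\mathbb{R}^{n\times r}$ has the corresponding product Euclidean structure. $\sigma_r(X)$ is the $r$th largest singular value of $X$. A point $y$ is $(\epsilon_1,\epsilon_2)$-approximate 2-critical for $g$ (with $\epsilon_1,\epsilon_2\geq0$) if $\|\nabla g(y)\|\leq\epsilon_1$ and $\lambda_{\min}(\nabla^2g(y))\geq-\epsilon_2$. The tangent cone of $\mathcal{X}$ at $x$ is $\mathrm{T}_x\mathcal{X}=\{v=\lim_{k\to\infty}(z_k-x)/\tau_k : z_k\in\mathcal{X},\ \tau_k>0,\ \tau_k\to 0,\text{ the limit exists}\}$, and $\operatorname{Proj}_{K}(v)$ is any closest point to $v$ in the closed cone $K$ (all have the same norm). *)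

(* Defs.v *)
From mathcomp Require Import all_boot all_order all_algebra.
From mathcomp Require polyrcf.
From mathcomp Require Import all_classical all_reals all_analysis.
Set Implicit Arguments.
Unset Strict Implicit.
Unset Printing Implicit Defensive.
Import Order.TTheory GRing.Theory Num.Theory.
Import numFieldTopology.Exports numFieldNormedType.Exports.
Local Open Scope classical_set_scope.
Local Open Scope ring_scope.

(* The library's norm `|.| on matrices and on products is the sup norm. It only
   provides the topology here (convergence, differentiability, continuity);
   every quantitative statement uses the Euclidean norms below. *)

Definition inner (K : realType) (m n : nat) (A B : 'M[K]_(m, n)) : K :=
  \tr (A^T *m B).

Definition fnorm (K : realType) (m n : nat) (A : 'M[K]_(m, n)) : K :=
  Num.sqrt (inner A A).

Definition inner2 (K : realType) (m n p q : nat)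
    (u v : 'M[K]_(m, n) * 'M[K]_(p, q)) : K :=
  inner u.1 v.1 + inner u.2 v.2.

Definition fnorm2 (K : realType) (m n p q : nat)
    (u : 'M[K]_(m, n) * 'M[K]_(p, q)) : K :=
  Num.sqrt (inner2 u u).

(* Gradients are given by partial derivatives along the standard orthonormal
   basis; [grad_innerE] and [grad2_innerE] show that they represent the
   differential in the inner products above. *)
Definition grad (K : realType) (m n : nat) (f : 'M[K]_(m, n) -> K)
    (X : 'M[K]_(m, n)) : 'M[K]_(m, n) :=
  \matrix_(i, j) 'D_(delta_mx i j) f X.

Definition grad2 (K : realType) (m n p q : nat)
    (g : 'M[K]_(m, n) * 'M[K]_(p, q) -> K)
    (y : 'M[K]_(m, n) * 'M[K]_(p, q)) : 'M[K]_(m, n) * 'M[K]_(p, q) :=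
  (\matrix_(i, j) 'D_((delta_mx i j, 0) : 'M[K]_(m, n) * 'M[K]_(p, q)) g y,
   \matrix_(i, j) 'D_((0, delta_mx i j) : 'M[K]_(m, n) * 'M[K]_(p, q)) g y).

Definition hess2 (K : realType) (m n p q : nat)
    (g : 'M[K]_(m, n) * 'M[K]_(p, q) -> K)
    (y v : 'M[K]_(m, n) * 'M[K]_(p, q)) : 'M[K]_(m, n) * 'M[K]_(p, q) :=
  'd (grad2 g) y v.

Lemma inner_delta (K : realType) (m n : nat) (A B : 'M[K]_(m, n)) :
  inner A B = \sum_i \sum_j A i j * B i j.
Proof.
rewrite /inner /mxtrace exchange_big /=; apply: eq_bigr => j _.
by rewrite mxE; apply: eq_bigr => i _; rewrite mxE.
Qed.

Lemma grad_innerE (K : realType) (m n : nat) (f : 'M[K]_(m, n) -> K)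
    (X V : 'M[K]_(m, n)) :
  differentiable f X -> 'd f X V = inner (grad f X) V.
Proof.
move=> df; rewrite inner_delta {1}(matrix_sum_delta V) linear_sum.
apply: eq_bigr => i _; rewrite linear_sum; apply: eq_bigr => j _.
by rewrite linearZ mxE deriveE // mulrC.
Qed.

Lemma grad2_innerE (K : realType) (m n p q : nat)
    (g : 'M[K]_(m, n) * 'M[K]_(p, q) -> K)
    (y v : 'M[K]_(m, n) * 'M[K]_(p, q)) :
  differentiable g y -> 'd g y v = inner2 (grad2 g y) v.
Proof.
move=> dg; rewrite /inner2 !inner_delta /=.
have {1}-> : v = \sum_i \sum_j v.1 i j *: (delta_mx i j, 0)
            + \sum_i \sum_j v.2 i j *: (0, delta_mx i j).
  have E1 (I : finType) (F : I -> 'M[K]_(m, n) * 'M[K]_(p, q)) :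
    (\sum_i F i) = (\sum_i (F i).1, \sum_i (F i).2).
    by rewrite -(raddf_sum fst) -(raddf_sum snd) -surjective_pairing.
  rewrite [LHS]surjective_pairing {1}(matrix_sum_delta v.1).
  rewrite {1}(matrix_sum_delta v.2) !E1 /=.
  congr (_, _); rewrite /=.
    rewrite [X in _ + X]big1 ?addr0 => [|i _].
      by apply: eq_bigr => i _; rewrite E1.
    by rewrite E1 /= big1 // => j _; rewrite scaler0.
  rewrite [X in X + _]big1 ?add0r => [|i _].
    by apply: eq_bigr => i _; rewrite E1.
  by rewrite E1 /= big1 // => j _; rewrite scaler0.
rewrite linearD !linear_sum; congr (_ + _); apply: eq_bigr => i _;
  rewrite linear_sum; apply: eq_bigr => j _; rewrite linearZ mxE deriveE //;
  exact: mulrC.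
Qed.

Definition C2 (K : realType) (m n : nat) (f : 'M[K]_(m, n) -> K) : Prop :=
  [/\ forall X, differentiable f X,
      forall X, differentiable (grad f) X
    & forall V, continuous (fun X => 'd (grad f) X V)].

Definition lipschitz_grad (K : realType) (m n : nat)
    (f : 'M[K]_(m, n) -> K) (Lf : K) : Prop :=
  forall X Y, fnorm (grad f X - grad f Y) <= Lf * fnorm (X - Y).

(* For a self-adjoint H on a nonzero finite-dimensional space, the set below is
   finite and nonempty, so that this [inf] is the smallest eigenvalue. *)
Definition lambda_min (K : realType) (V : lmodType K) (H : V -> V) : K :=
  inf [set mu | exists2 v, v != 0 & H v = mu *: v].

Definition approx_2critical (K : realType) (m n p q : nat) (eps1 eps2 : K)
    (g : 'M[K]_(m, n) * 'M[K]_(p, q) -> K)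
    (y : 'M[K]_(m, n) * 'M[K]_(p, q)) : Prop :=
  fnorm2 (grad2 g y) <= eps1 /\ - eps2 <= lambda_min (hess2 g y).

Definition lift_LR (K : realType) (m n r : nat) (f : 'M[K]_(m, n) -> K)
    (y : 'M[K]_(m, r) * 'M[K]_(n, r)) : K :=
  f (y.1 *m y.2^T).

(* Real eigenvalues, in increasing order and repeated with their algebraic
   multiplicity: [rootsR p] is the increasing list of the distinct real roots
   of p; see [eigenvaluesE]. *)
Definition eigenvalues (K : realType) (n : nat) (A : 'M[K]_n) : seq K :=
  flatten [seq nseq (mup x (char_poly A)) x
          | x <- polyrcf.rootsR (char_poly A)].

Lemma eigenvaluesE (K : realType) (n : nat) (A : 'M[K]_n) (s : seq K) :
  char_poly A = \prod_(a <- s) ('X - a%:P) -> sorted <=%R s ->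
  eigenvalues A = s.
Proof.
move=> As s_sorted; rewrite /eigenvalues As.
set p := \prod_(a <- s) _.
have p0 : p != 0 by rewrite monic_neq0 // monic_prod_XsubC.
have roots_sorted : sorted <%R (polyrcf.rootsR p) by exact: polyrcf.sorted_roots.
have rootsE x : (x \in polyrcf.rootsR p) = (x \in s).
  by rewrite -(polyrcf.roots_on_rootsR p0) root_prod_XsubC.
apply: (sorted_eq le_trans le_anti) => //.
  elim: (polyrcf.rootsR p) roots_sorted => //= x t IH.
  rewrite lt_path_sortedE => /andP[/allP xt t_sorted].
  elim: (mup x p) => [|k IHk] /=; first exact: IH.
  rewrite le_path_sortedE IHk andbT; apply/allP => y.
  rewrite mem_cat mem_nseq => /orP[/andP[_ /eqP->]//|/flattenP[u /mapP[z zt ->]]].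
  by rewrite mem_nseq => /andP[_ /eqP->]; exact/ltW/xt.
have roots_uniq := sorted_uniq lt_trans ltxx roots_sorted.
apply/allP => x _ /=; apply/eqP; rewrite count_flatten -map_comp sumnE big_map.
under eq_bigr do rewrite /= count_nseq.
rewrite -(mu_prod_XsubC x s) -/p.
have [xr|xr] := boolP (x \in polyrcf.rootsR p).
  rewrite (bigD1_seq x) //= eqxx mul1n big1 ?addn0 // => y /negPf yx.
  by rewrite yx.
rewrite big_seq big1 => [|y yr].
  by rewrite mupNroot // root_prod_XsubC -rootsE.
have /negPf yx : y != x by apply: contraNneq xr => <-.
by rewrite /= yx.
Qed.

(* X^T X is n x n; when m < n, [take] drops the n - m extra zeros. *)
Definition singular_values (K : realType) (m n : nat) (X : 'M[K]_(m, n)) :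
    seq K :=
  take (minn m n) [seq Num.sqrt x | x <- rev (eigenvalues (X^T *m X))].

(* k-th largest singular value, for 1 <= k <= minn m n. *)
Definition sigma (K : realType) (m n : nat) (k : nat) (X : 'M[K]_(m, n)) : K :=
  nth 0 (singular_values X) k.-1.

Definition opnorm (K : realType) (m n : nat) (X : 'M[K]_(m, n)) : K :=
  sigma 1 X.

Definition rank_le (K : realType) (m n r : nat) : set 'M[K]_(m, n) :=
  [set X | (\rank X <= r)%N].

Definition tangent_cone (K : realType) (m n : nat) (S : set 'M[K]_(m, n))
    (x : 'M[K]_(m, n)) : set 'M[K]_(m, n) :=
  [set v | exists (z : nat -> 'M[K]_(m, n)) (tau : nat -> K),
     [/\ forall k, S (z k),
         forall k, 0 < tau k,
         tau k @[k --> \oo] --> 0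
       & (tau k)^-1 *: (z k - x) @[k --> \oo] --> v]].

(* w is a closest point of C to v; it need not be unique when C is not convex. *)
Definition is_proj (K : realType) (m n : nat) (C : set 'M[K]_(m, n))
    (v w : 'M[K]_(m, n)) : Prop :=
  C w /\ forall u, C u -> fnorm (v - w) <= fnorm (v - u).

(* Main.v *)
(* With X = L R^T, G the gradient of f at X and M = L^T L = R^T R, the nonzero
   eigenvalues of X^T X are those of M^2, so sigma_r(X) is the smallest eigenvalue
   of M. Let w be a unit eigenvector for it. The Hessian of g along
   (u w^T, - v w^T) is - 2 u^T G v plus the Hessian of f along
   Z = u (R w)^T - (L w) v^T, and |Z|^2 <= 4 sigma_r(X) for unit u, v; hence
   u^T G v <= eps2 + 2 Lf sigma_r(X).

   A projection P of - G on a cone satisfies |P|^2 <= <- G, P>, so that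
   |P| <= |G| <= sqrt (rank G) |G|_op. When rank X = r, a tangent vector is
   P = A R^T + L C^T with L^T A = 0, so the two terms are orthogonal,
   |P|^2 >= sigma_r(X) (|A|^2 + |C|^2), while <- G, P> is the pairing of
   - grad g (L, R) = - (G R, G^T L) with (A, C). *)

From HB Require Import structures.
Require Import Defs.
From mathcomp Require Import all_boot all_order all_algebra.
From mathcomp Require complex.
From mathcomp Require Import all_classical all_reals all_analysis.
From mathcomp Require Import ring lra.
Import Order.TTheory GRing.Theory Num.Theory.
Import numFieldTopology.Exports numFieldNormedType.Exports.
Local Open Scope classical_set_scope.
Local Open Scope ring_scope.

Set Implicit Arguments.
Unset Strict Implicit.
Unset Printing Implicit Defensive.

(** * Symmetric matrices *)

(** Keeping the rows and columns with a nonzero entry, and rescaling the columns, cuts an identity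
    matrix out of [diag_mx d]. *)
Lemma rank_diag_mx_ge (F : fieldType) n (d : 'rV[F]_n) :
  (#|[pred i | d 0 i != 0]%R| <= \rank (diag_mx d))%N.
Proof.
pose S := \matrix_(a < #|[pred i | d 0 i != 0]%R|, j < n)
  ((j == enum_val a)%:R : F).
pose T := \matrix_(j < n, b < #|[pred i | d 0 i != 0]%R|)
  ((j == enum_val b)%:R / d 0 j : F).
have ST : S *m diag_mx d *m T = 1%:M.
  rewrite mul_mx_diag.
  apply/matrixP => a b; rewrite !mxE (bigD1 (enum_val a)) //= big1 => [|j ja].
    rewrite addr0 !mxE eqxx mul1r.
    have := enum_valP a; rewrite inE => da.
    by rewrite mulrCA divff // mulr1 (inj_eq enum_val_inj).

  by rewrite !mxE (negPf ja) !mul0r.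
rewrite -[X in (X <= _)%N](mxrank1 F) -ST.
exact: leq_trans (mxrankM_maxl _ _) (mxrankM_maxr _ _).
Qed.

Lemma char_poly_diagonalized (F : fieldType) n (P : 'M[F]_n) (d : 'rV[F]_n) :
  P \in unitmx ->
  char_poly (invmx P *m diag_mx d *m P) = \prod_i ('X - (d 0 i)%:P).
Proof.
move=> Pu; transitivity (char_poly (diag_mx d)); last first.
  rewrite char_poly_trig ?diag_mx_is_trig //; apply: eq_bigr => i _.
  by rewrite !mxE eqxx mulr1n.
rewrite /char_poly.
have -> : char_poly_mx (invmx P *m diag_mx d *m P) =
  map_mx polyC (invmx P) *m char_poly_mx (diag_mx d) *m map_mx polyC P.
  rewrite /char_poly_mx mulmxBr mulmxBl mul_mx_scalar -scalemxAl.
  rewrite -[in RHS]map_mxM mulVmx // map_mx1 scalemx1.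
  by rewrite !map_mxM.
by rewrite !det_mulmx mulrAC -det_mulmx -map_mxM mulVmx // map_mx1 det1 mul1r.
Qed.

Section SymmetricSpectral.
Import complex.

(** Over [K[i]] the matrix becomes Hermitian, hence unitarily diagonalizable with real eigenvalues
    [d]. The weights [c i] are the squared moduli of the coordinates of [x] in the eigenbasis; they
    are real, so every conclusion descends to [K]. *)
Lemma sym_spectral (K : rcfType) n (A : 'M[K]_n) : A^T = A ->
  exists d : 'rV[K]_n,
  [/\ char_poly A = \prod_i ('X - (d 0 i)%:P),
      char_poly (A *m A) = \prod_i ('X - (d 0 i ^+ 2)%:P),
      (#|[pred i | d 0 i != 0]%R| <= \rank A)%N
    & forall x : 'rV[K]_n, exists c : 'I_n -> K,
      [/\ forall i, 0 <= c i, (x *m x^T) 0 0 = \sum_i c i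
        & (x *m A *m x^T) 0 0 = \sum_i d 0 i * c i]].
Proof.
move=> As; pose C : numClosedFieldType := complex.complex K.
pose tc := (complex.real_complex K : {rmorphism K -> C}).
pose AC := map_mx tc A.
have tc_real x : tc x \is Num.real by rewrite complex.complex_real.
have tcJ x : (tc x)^* = tc x by apply/CrealP.
have tcI : injective tc by exact: complex.complexI.
have ACherm : AC \is hermsymmx.
  apply/is_hermitianmxP; rewrite expr0 scale1r; apply/matrixP => i j.
  by rewrite !mxE /= tcJ -[in RHS]As mxE.
have /hermitian_spectral_diag_real spr := ACherm.
have := ACherm => /hermitian_normalmx/orthomx_spectralP.
set P := spectralmx AC; set sp := spectral_diag AC => ACE.
have PU : P \is unitarymx by exact: spectral_unitarymx.
have Pu : P \in unitmx by exact: spectral_unit.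
pose d := map_mx (@complex.Re K) sp : 'rV[K]_n.
have spE : sp = map_mx tc d.
  apply/matrixP => i j; rewrite !mxE.
  by have /mxOverP/(_ i j)/complex.RRe_real := spr; rewrite /= => ->.
exists d; split.
- apply: (@map_poly_inj _ _ tc); rewrite rmorph_prod /= map_char_poly -/AC.
  rewrite ACE char_poly_diagonalized //; apply: eq_bigr => i _.
  by rewrite rmorphB /= map_polyX map_polyC /= spE mxE.
- apply: (@map_poly_inj _ _ tc); rewrite rmorph_prod /= map_char_poly.
  rewrite map_mxM -/AC ACE !mulmxA mulmxK // -[X in X *m P]mulmxA mulmx_diag.
  rewrite char_poly_diagonalized //; apply: eq_bigr => i _.
  by rewrite rmorphB /= map_polyX map_polyC /= spE !mxE rmorphXn expr2.
- rewrite -(mxrank_map tc) -/AC ACE mxrankMfree ?row_free_unit //.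
  rewrite eqmxMfull ?row_full_unit ?unitmx_inv // spE -map_diag_mx mxrank_map.
  exact: rank_diag_mx_ge.
move=> x; pose y := map_mx tc x *m invmx P.
pose c i := complex.Re (y 0 i * (y 0 i)^*).
have cE i : tc (c i) = y 0 i * (y 0 i)^*.
  by apply: complex.RRe_real; rewrite ger0_real // mul_conjC_ge0.
have xJ : map_mx Num.conj (map_mx tc x) = map_mx tc x.
  by apply/matrixP => i j; rewrite !mxE tcJ.
have yt : map_mx Num.conj y^T = P *m (map_mx tc x)^T.
  rewrite /y trmx_mul map_mxM /= invmx_unitary // -!map_trmx trmxK xJ.
  by rewrite -map_mx_comp (map_mx_id (@conjCK _)).
have xxE : map_mx tc (x *m x^T) = y *m map_mx Num.conj y^T.
  by rewrite yt /y mulmxA mulmxKV // map_mxM map_trmx.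
have xAxE : map_mx tc (x *m A *m x^T) = y *m diag_mx sp *m map_mx Num.conj y^T.
  by rewrite yt /y !map_mxM -/AC {1}ACE !mulmxA map_trmx.
exists c; split.
- move=> i; rewrite -(complex.ler0c) -[X in _ <= X]/(tc (c i)) cE.
  exact: mul_conjC_ge0.
- apply: tcI; rewrite rmorph_sum /=.
  have /matrixP/(_ 0 0) := xxE; rewrite !mxE => ->; apply: eq_bigr => i _.
  by rewrite cE !mxE.
apply: tcI; rewrite rmorph_sum /=.
have /matrixP/(_ 0 0) := xAxE; rewrite mxE [in RHS]mxE => ->.
apply: eq_bigr => i _.
by rewrite rmorphM cE mul_mx_diag !mxE spE mxE -mulrA mulrCA.
Qed.

End SymmetricSpectral.

(** * Inner products and smallest eigenvalues *)

(** Sylvester's identity: two block triangular products of [W] show that its determinant is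
    [char_poly (A *m B)] and that, multiplied by ['X^r], it is ['X^n * char_poly (B *m A)]. *)
Lemma char_poly_mulmxC (F : fieldType) n r (A : 'M[F]_(n, r)) (B : 'M[F]_(r, n)) :
  (r <= n)%N -> char_poly (A *m B) = 'X^(n - r) * char_poly (B *m A).
Proof.
move=> rn; pose a := map_mx polyC A; pose b := map_mx polyC B.
pose W := block_mx ('X%:M : 'M[{poly F}]_n) a b (1%:M : 'M[{poly F}]_r).
have W1 : W *m block_mx 1%:M 0 (- b) 1%:M = block_mx (char_poly_mx (A *m B)) a 0 1%:M.
  rewrite mulmx_block !mulmx1 !mulmx0 !mul1mx mulmxN !add0r subrr.
  by rewrite /char_poly_mx map_mxM.
have W2 : W *m block_mx 1%:M (- a) 0 'X%:M = block_mx 'X%:M 0 b (char_poly_mx (B *m A)).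
  rewrite mulmx_block !mulmx1 !mulmx0 !mul1mx !mulmxN !addr0.
  rewrite mul_scalar_mx mul_mx_scalar addNr addrC.
  by rewrite /char_poly_mx map_mxM.
have := congr1 determinant W1; have := congr1 determinant W2.
rewrite !det_mulmx !det_ublock !det_lblock !det1 !mul1r !mulr1 !det_scalar.
rewrite -/(char_poly _) -/(char_poly _) => + WE; rewrite WE.
have -> : 'X^n = 'X^r * 'X^(n - r) :> {poly F} by rewrite -exprD subnKC.
rewrite -mulrA [LHS]mulrC.
by move=> /(mulfI (monic_neq0 (monicXn _ _))).
Qed.

Section Gram.
Context {K : realType}.

Lemma innerC m n (A B : 'M[K]_(m, n)) : inner A B = inner B A.
Proof. by rewrite /inner -mxtrace_tr trmx_mul trmxK. Qed.

Lemma innerDl m n (A B C : 'M[K]_(m, n)) : inner (A + B) C = inner A C + inner B C.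
Proof. by rewrite /inner linearD mulmxDl linearD. Qed.

Lemma innerZl m n a (A B : 'M[K]_(m, n)) : inner (a *: A) B = a * inner A B.
Proof. by rewrite /inner linearZ -scalemxAl linearZ. Qed.

Lemma innerDr m n (A B C : 'M[K]_(m, n)) : inner A (B + C) = inner A B + inner A C.
Proof. by rewrite innerC innerDl !(innerC _ A). Qed.

Lemma innerZr m n a (A B : 'M[K]_(m, n)) : inner A (a *: B) = a * inner A B.
Proof. by rewrite innerC innerZl innerC. Qed.

Lemma innerNl m n (A B : 'M[K]_(m, n)) : inner (- A) B = - inner A B.
Proof. by rewrite -scaleN1r innerZl mulN1r. Qed.

Lemma innerNr m n (A B : 'M[K]_(m, n)) : inner A (- B) = - inner A B.
Proof. by rewrite innerC innerNl innerC. Qed.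

Lemma inner_trmx m n (A B : 'M[K]_(m, n)) : inner A^T B^T = inner A B.
Proof. by rewrite innerC /inner trmxK mxtrace_mulC. Qed.

Lemma inner_mulmxr m n p (A : 'M[K]_(m, n)) (B : 'M[K]_(n, p)) C :
  inner (A *m B) C = inner A (C *m B^T).
Proof. by rewrite /inner trmx_mul -mulmxA mxtrace_mulC mulmxA. Qed.

Lemma inner_mulmxl m n p (A : 'M[K]_(m, n)) (B : 'M[K]_(n, p)) C :
  inner (A *m B) C = inner B (A^T *m C).
Proof. by rewrite /inner trmx_mul mulmxA. Qed.

Lemma inner_ge0 m n (A : 'M[K]_(m, n)) : 0 <= inner A A.
Proof.
by rewrite inner_delta; do 2![apply: sumr_ge0 => ? _]; rewrite -expr2 sqr_ge0.
Qed.

Lemma inner_eq0 m n (A : 'M[K]_(m, n)) : (inner A A == 0) = (A == 0).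
Proof.
apply/eqP/eqP => [|->]; last by rewrite /inner mulmx0 linear0.
rewrite inner_delta => /eqP; rewrite psumr_eq0 => [/allP A0|i _]; last first.
  by apply: sumr_ge0 => j _; rewrite -expr2 sqr_ge0.
apply/matrixP => i j; rewrite mxE; apply/eqP.
have := A0 i (mem_index_enum _).
rewrite psumr_eq0 => [/allP/(_ j (mem_index_enum _))|k _].
  by rewrite -expr2 sqrf_eq0.
by rewrite -expr2 sqr_ge0.
Qed.

Lemma rV_dotE n (x y : 'rV[K]_n) : (x *m y^T) 0 0 = inner x y.
Proof. by rewrite innerC /inner mxtrace_mulC trace_mx11. Qed.

Lemma fnorm_ge0 m n (A : 'M[K]_(m, n)) : 0 <= fnorm A.
Proof. exact: sqrtr_ge0. Qed.

Lemma fnorm_sqr m n (A : 'M[K]_(m, n)) : fnorm A ^+ 2 = inner A A.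
Proof. by rewrite sqr_sqrtr // inner_ge0. Qed.

(** An abstract form covers both [inner] and [inner2]. The polynomial [phi (a x + y) (a x + y)] in
    [a] is never negative, which is tested at a suitable [a]. *)
Lemma cauchy_schwarz_form (V : lmodType K) (phi : V -> V -> K) :
  (forall x y, phi x y = phi y x) ->
  (forall a x y z, phi (a *: x + y) z = a * phi x z + phi y z) ->
  (forall x, 0 <= phi x x) ->
  forall x y, phi x y <= Num.sqrt (phi x x) * Num.sqrt (phi y y).
Proof.
move=> phiC phiL phi_ge0 x y; rewrite -sqrtrM //.
have [xy0|xy0] := leP (phi x y) 0; first exact: le_trans xy0 (sqrtr_ge0 _).
rewrite -[leLHS](ger0_norm (ltW xy0)) -sqrtr_sqr ler_sqrt ?mulr_ge0 //.
have E a : 0 <= a ^+ 2 * phi x x + 2 * a * phi x y + phi y y.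
  have := phi_ge0 (a *: x + y).
  rewrite phiL (phiC x) (phiC y) !phiL (phiC y x) => /le_trans; apply.
  by rewrite le_eqVlt; apply/orP; left; apply/eqP; ring.
have [x0|x0] := leP (phi x x) 0.
  have /eqP x0' : phi x x == 0 by rewrite eq_le x0 phi_ge0.
  (* Here the polynomial is affine in [a], and this [a] gives it the value [-1]. *)
  have := E (- (phi y y + 1) / (2 * phi x y)).
  rewrite x0' mulr0 add0r.
  have -> : 2 * (- (phi y y + 1) / (2 * phi x y)) * phi x y = - (phi y y + 1).
    by field; rewrite gt_eqF.
  lra.
(* This [a] minimizes the quadratic polynomial. *)
have := E (- phi x y / phi x x).
have -> : (- phi x y / phi x x) ^+ 2 * phi x x + 2 * (- phi x y / phi x x) * phi x y
  + phi y y = (phi x x * phi y y - phi x y ^+ 2) / phi x x.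
  by field; rewrite gt_eqF.
by rewrite pmulr_lge0 ?invr_gt0 // subr_ge0.
Qed.

Lemma inner_le_fnorm m n (A B : 'M[K]_(m, n)) : inner A B <= fnorm A * fnorm B.
Proof.
apply: (@cauchy_schwarz_form _ (@inner K m n)) => [x y|a x y z|x].
- exact: innerC.
- by rewrite innerDl innerZl.
- exact: inner_ge0.
Qed.

Lemma inner2_le_fnorm2 m n p q (u v : 'M[K]_(m, n) * 'M[K]_(p, q)) :
  inner2 u v <= fnorm2 u * fnorm2 v.
Proof.
apply: (@cauchy_schwarz_form _ (@inner2 K m n p q)) => [x y|a x y z|x].
- by rewrite /inner2 !(innerC x.1, innerC x.2).
- by rewrite /inner2 !innerDl !innerZl; ring.
- by rewrite addr_ge0 ?inner_ge0.
Qed.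

Lemma root_char_eigenvector n (A : 'M[K]_n) (d : 'rV[K]_n) (i : 'I_n) :
  char_poly A = \prod_i ('X - (d 0 i)%:P) ->
  exists2 v : 'rV[K]_n, v != 0 & v *m A = d 0 i *: v.
Proof.
move=> Ad; have /eigenvalueP[v vA v0] : eigenvalue A (d 0 i).
  rewrite eigenvalue_root_char Ad /root horner_prod.
  by rewrite (bigD1 i) //= hornerXsubC subrr mul0r.
by exists v.
Qed.

(** By [sym_spectral] the form is a combination of the eigenvalues with nonnegative weights of total
    [inner x x], so the least eigenvalue bounds it from below. *)
Lemma sym_min_eigenvector n (A : 'M[K]_n) : (0 < n)%N -> A^T = A ->
  exists mu, (exists2 v : 'rV[K]_n, v != 0 & v *m A = mu *: v) /\
    (forall x : 'rV[K]_n, mu * inner x x <= inner (x *m A) x).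
Proof.
move=> n0 /sym_spectral[d [Ad _ _ dq]].
have [i0 _ i0_min] := @arg_minP _ _ _ (Ordinal n0) xpredT (fun i => d 0 i) isT.
exists (d 0 i0); split; first exact: root_char_eigenvector.
move=> x; have [c [c0]] := dq x; rewrite !rV_dotE => -> ->.
by rewrite mulr_sumr; apply: ler_sum => i _; rewrite ler_wpM2r // i0_min.
Qed.

Lemma inner_vec_mx m n (a b : 'rV[K]_(m * n)) :
  inner (vec_mx a) (vec_mx b) = inner a b.
Proof.
rewrite !inner_delta big_ord1 pair_bigA /=.
rewrite [RHS](reindex _ (curry_mxvec_bij m n)) /=.
by apply: eq_bigr => -[i j] _; rewrite !mxE.
Qed.

(** Vectorization is an isometry carrying [S] to a symmetric matrix [A]. Its smallest eigenvalue
    [mu] satisfies the Rayleigh inequality, so it suffices that [lambda_min S <= mu]. *)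
Lemma lambda_min_le m n p q (S : {linear ('M[K]_(m, n) * 'M[K]_(p, q))%type ->
    ('M[K]_(m, n) * 'M[K]_(p, q))%type}) : (0 < m * n + p * q)%N ->
  (forall u v, inner2 (S u) v = inner2 (S v) u) ->
  forall v, lambda_min S * inner2 v v <= inner2 (S v) v.
Proof.
move=> N0 Ssym v.
pose phi (x : 'rV[K]_(m * n + p * q)) := (vec_mx (lsubmx x), vec_mx (rsubmx x)).
pose psi (u : 'M[K]_(m, n) * 'M[K]_(p, q)) := row_mx (mxvec u.1) (mxvec u.2).
have phiK : cancel phi psi by move=> x; rewrite /phi /psi /= !vec_mxK hsubmxK.
have psiK : cancel psi phi.
  by move=> [a b]; rewrite /phi /psi row_mxKl row_mxKr !mxvecK.
have phi_dot x y : inner2 (phi x) (phi y) = inner x y.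
  rewrite /inner2 /= !inner_vec_mx -[in RHS](hsubmxK x) -[in RHS](hsubmxK y) /inner.
  by rewrite tr_row_mx mul_col_row mxtrace_block.
have flin : linear (psi \o S \o phi).
  move=> a x y; rewrite /= /phi /psi !linearP /=.
  have -> : (a *: vec_mx (lsubmx x) + vec_mx (lsubmx y),
             a *: vec_mx (rsubmx x) + vec_mx (rsubmx y)) = a *: phi x + phi y by [].
  by rewrite linearP /= !linearP /= -add_row_mx -scale_row_mx.
pose F : {linear 'rV[K]_(m * n + p * q) -> 'rV[K]_(m * n + p * q)} :=
  HB.pack (psi \o S \o phi) (GRing.isLinear.Build _ _ _ _ _ flin).
pose A := lin1_mx F.
have AE x : x *m A = psi (S (phi x)) by rewrite mul_rV_lin1.
have A_dot x y : inner (x *m A) y = inner2 (S (phi x)) (phi y).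
  by rewrite AE -phi_dot psiK.
have Asym : A^T = A.
  apply/matrixP => i j.
  have E k l : A k l = inner (delta_mx 0 k *m A) (delta_mx 0 l : 'rV_(_)).
    by rewrite -rV_dotE -rowE trmx_delta -colE !mxE.
  by rewrite mxE !E !A_dot Ssym.
have [mu [[w w0 wA] mu_min]] := sym_min_eigenvector N0 Asym.
have mu_le u : mu * inner2 u u <= inner2 (S u) u.
  by have := mu_min (psi u); rewrite A_dot -phi_dot psiK.
apply: le_trans (mu_le v); rewrite ler_wpM2r ?addr_ge0 ?inner_ge0 //.
(* An [inf] is known to lie below the elements of its set once the set has a lower bound: the
   Rayleigh inequality makes [mu] one. Then [phi w] shows that [mu] belongs to the set. *)
apply: ge_inf.
  exists mu => nu [u u0 Su]; have := mu_le u.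
  have uu0 : 0 < inner2 u u.
    rewrite lt_neqAle eq_sym addr_ge0 ?inner_ge0 // andbT /inner2.
    rewrite paddr_eq0 ?inner_ge0 // !inner_eq0.
    by case: u u0 {Su} => a b; rewrite -pair_eqE.
  rewrite Su /inner2 !innerZl -mulrDr ler_pM2r //.
exists (phi w).
  by apply: contraNneq w0 => pw; rewrite -[w]phiK pw /psi !linear0 row_mx0.
apply: (can_inj psiK); rewrite -AE wA /psi !linearZ /= -scale_row_mx.
by congr (_ *: _); rewrite -[LHS]phiK.
Qed.

End Gram.

(** * Singular values *)

Section SingularValues.
Context {K : realType}.

Lemma root_eigenvalues n (A : 'M[K]_n) x :
  x \in eigenvalues A -> root (char_poly A) x.
Proof.
have A0 : char_poly A != 0 by rewrite monic_neq0 // char_poly_monic.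
move=> /flattenP[u /mapP[z]]; rewrite -(polyrcf.roots_on_rootsR A0) => zr ->.
by rewrite mem_nseq => /andP[_ /eqP->].
Qed.

Lemma eigenvalue_le_form n (A : 'M[K]_n) (b x : K) :
  (forall v : 'rV[K]_n, inner (v *m A) v <= b * inner v v) ->
  root (char_poly A) x -> x <= b.
Proof.
move=> Ab; rewrite -eigenvalue_root_char => /eigenvalueP[v vA v0].
have := Ab v; rewrite vA innerZl ler_pM2r //.
by rewrite lt_neqAle eq_sym inner_eq0 v0 inner_ge0.
Qed.

Lemma opnorm_le m n (A : 'M[K]_(m, n)) (b : K) : 0 <= b ->
  (forall v : 'rV[K]_n, inner (v *m (A^T *m A)) v <= b ^+ 2 * inner v v) ->
  opnorm A <= b.
Proof.
move=> b0 Ab; rewrite /opnorm /sigma /=.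
(* An empty list of singular values gives the default [0], which [b0] covers. *)
have [s0|/(nth_default 0)->//] := ltnP 0 (size (singular_values A)).
have /mem_take/mapP[x] := mem_nth 0 s0; rewrite mem_rev => xA ->.
rewrite -(ger0_norm b0) -sqrtr_sqr ler_wsqrtr //.
exact/(eigenvalue_le_form Ab)/root_eigenvalues.
Qed.

(** The squared Frobenius norm is the trace of [A^T *m A], a sum of eigenvalues of which at most
    [\rank A] are nonzero, each at most [b ^+ 2]. *)
Lemma fnorm_le_rank m n (A : 'M[K]_(m, n)) (b : K) : 0 <= b ->
  (forall v : 'rV[K]_n, inner (v *m (A^T *m A)) v <= b ^+ 2 * inner v v) ->
  fnorm A <= Num.sqrt (\rank A)%:R * b.
Proof.
move=> b0 Ab.
have Ssym : (A^T *m A)^T = A^T *m A by rewrite trmx_mul trmxK.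
have [d [Sd _ Srank _]] := sym_spectral Ssym.
have trS : \tr (A^T *m A) = \sum_i d 0 i.
  (* The trace is read off a coefficient of the characteristic polynomial, which requires a positive
     size. *)
  have [n0|n0] := posnP n.
    by rewrite /mxtrace !big1 // => i; have := ltn_ord i; rewrite [X in (_ < X)%N]n0.
  apply: oppr_inj; rewrite -char_poly_trace // Sd.
  have sz : size [seq d 0 i | i <- enum 'I_n] = n by rewrite size_map size_enum_ord.
  have := @coefPn_prod_XsubC _ [seq d 0 i | i <- enum 'I_n].
  by rewrite sz -lt0n big_map big_enum /= big_map big_enum; apply.
rewrite -(ger0_norm b0) -(sqrtr_sqr b) -sqrtrM // ler_wsqrtr //.
rewrite [inner A A]trS (bigID (fun i => d 0 i == 0)) /=.
rewrite big1 ?add0r => [|i /eqP//].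
apply: (@le_trans _ _ (\sum_(i | d 0 i != 0) b ^+ 2)).
  apply: ler_sum => i _; apply: (eigenvalue_le_form Ab).
  by rewrite Sd /root horner_prod (bigD1 i) //= hornerXsubC subrr mul0r.
rewrite sumr_const -[leLHS]mulr_natl ler_wpM2r ?sqr_ge0 // ler_nat.
exact: leq_trans Srank (mxrankM_maxr _ _).
Qed.

Lemma inner_gram m n (A : 'M[K]_(m, n)) (x : 'rV[K]_n) :
  inner (x *m (A^T *m A)) x = inner (A *m x^T) (A *m x^T).
Proof.
by rewrite -rV_dotE /inner trmx_mul trmxK trace_mx11 !mulmxA.
Qed.

(* [X^T X = R (M R^T)] with [M = R^T R] has the same characteristic polynomial
   as [(M R^T) R = M^2] up to a power of ['X], so the [r] largest singular values
   of [X] are the eigenvalues of [M]. *)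
Lemma sigma_balanced m n r (L : 'M[K]_(m, r)) (R : 'M[K]_(n, r)) :
  (1 <= r)%N -> (r <= minn m n)%N -> L^T *m L = R^T *m R ->
  let s := sigma r (L *m R^T) in
  [/\ 0 <= s, exists2 w : 'rV[K]_r, w != 0 & w *m (R^T *m R) = s *: w
    & forall x : 'rV[K]_r, s * inner x x <= inner (x *m (R^T *m R)) x].
Proof.
move=> r1 r_le LR /=; set X := L *m R^T; set M := R^T *m R.
have rn : (r <= n)%N by rewrite (leq_trans r_le) // geq_minr.
have Msym : M^T = M by rewrite trmx_mul trmxK.
have [d [Md MMd _ dq]] := sym_spectral Msym.
have d_ge0 i : 0 <= d 0 i.
  have [v v0 vM] := root_char_eigenvector i Md.
  have vv0 : 0 < inner v v by rewrite lt_neqAle eq_sym inner_eq0 v0 inner_ge0.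
  by rewrite -(pmulr_lge0 _ vv0) -innerZl -vM inner_gram inner_ge0.
pose s0 := sort <=%R [seq d 0 i | i <- enum 'I_r].
have s0_sorted : sorted <=%R s0 by exact: sort_le_sorted.
have s0_size : size s0 = r by rewrite size_sort size_map size_enum_ord.
have s0_mem x : (x \in s0) = [exists i, x == d 0 i].
  rewrite mem_sort; apply/mapP/existsP => [[i _ ->]|[i /eqP->]]; exists i => //.
  by rewrite mem_enum.
have s0_ge0 x : x \in s0 -> 0 <= x by rewrite s0_mem => /existsP[i /eqP->].
(* The eigenvalues of [X^T X] in increasing order, in terms of the sorted eigenvalues [s0] of
   [M]. *)
pose t := nseq (n - r) 0 ++ [seq x ^+ 2 | x <- s0].
have XE : char_poly (X^T *m X) = \prod_(a <- t) ('X - a%:P).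
  rewrite /X trmx_mul trmxK mulmxA -(mulmxA R) LR -/M -mulmxA.
  rewrite char_poly_mulmxC // -mulmxA MMd big_cat /=; congr (_ * _).
    elim: (n - r)%N => [|k IH] /=; first by rewrite big_nil.
    by rewrite big_cons subr0 exprS IH.
  rewrite big_map (perm_big [seq d 0 i | i <- enum 'I_r]) ?perm_sort //=.
  by rewrite big_map big_enum.
have t_sorted : sorted <=%R t.
  rewrite sorted_pairwise; last exact: le_trans.
  rewrite pairwise_cat; apply/and3P; split.
  - apply/allrelP => x y; rewrite mem_nseq => /andP[_ /eqP->] /mapP[z _ ->].
    exact: sqr_ge0.
  - elim: (n - r)%N => //= k ->; rewrite andbT; apply/allP => x.
    by rewrite mem_nseq => /andP[_ /eqP->].
  rewrite -sorted_pairwise; last exact: le_trans.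
  apply: (homo_sorted_in (P := [pred x | 0 <= x])) s0_sorted.
    by move=> x y x0 y0 xy; rewrite ler_pXn2r.
  by apply/allP => x /s0_ge0.
have sE : sigma r X = nth 0 s0 0.
  (* Reversed, [t] starts with the [r] squares in decreasing order, so index [r.-1] hits the square
     of the head of [s0]; [take] keeps it because [r <= minn m n]. *)
  rewrite /sigma /singular_values (eigenvaluesE XE t_sorted).
  rewrite nth_take ?prednK // /t rev_cat map_cat nth_cat.
  rewrite size_map size_rev size_map s0_size prednK // leqnn.
  rewrite (nth_map 0) ?size_rev ?size_map ?s0_size ?prednK //.
  rewrite nth_rev ?size_map ?s0_size ?prednK // subnn.
  rewrite (nth_map 0) ?s0_size // sqrtr_sqr ger0_norm //.
  by apply/s0_ge0/mem_nth; rewrite s0_size.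
have s_mem : sigma r X \in s0 by rewrite sE mem_nth // s0_size.
have s_min i : sigma r X <= d 0 i.
  have : d 0 i \in s0 by rewrite s0_mem; apply/existsP; exists i.
  rewrite sE; case: (s0) s0_sorted => //= h tl /(order_path_min le_trans)/allP.
  by move=> h_min; rewrite inE => /predU1P[->//|/h_min].
split; first exact: s0_ge0.
  have := s_mem; rewrite s0_mem => /existsP[i /eqP->].
  exact: root_char_eigenvector.
move=> x; have [c [c0]] := dq x; rewrite !rV_dotE => -> ->.
by rewrite mulr_sumr; apply: ler_sum => i _; rewrite ler_wpM2r.
Qed.

End SingularValues.

(** * The tangent cone of bounded-rank matrices *)

Section MatrixLimits.
Context {K : realType} {T : Type} {F : set_system T} {FF : Filter F}.

Lemma cvg_mx m n (A : T -> 'M[K]_(m, n)) (B : 'M[K]_(m, n)) :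
  (forall i j, A x i j @[x --> F] --> B i j) -> A x @[x --> F] --> B.
Proof.
move=> AB; rewrite [B]matrix_sum_delta.
under eq_cvg do rewrite [A _]matrix_sum_delta.
apply: cvg_big => [|i _]; first exact: add_continuous.
apply: cvg_big => [|j _]; first exact: add_continuous.
exact: cvgZr_tmp.
Qed.

Lemma cvg_mx_coord m n (A : T -> 'M[K]_(m, n)) (B : 'M[K]_(m, n)) i j :
  A x @[x --> F] --> B -> A x i j @[x --> F] --> B i j.
Proof.
move=> AB; exact: (cvg_comp (fun x => A x) (fun M : 'M[K]_(m, n) => M i j) AB
  (@coord_continuous K m n i j B)).
Qed.

Lemma cvg_mulmx m n p (A : T -> 'M[K]_(m, n)) (B : T -> 'M[K]_(n, p))
    (a : 'M[K]_(m, n)) (b : 'M[K]_(n, p)) :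
  A x @[x --> F] --> a -> B x @[x --> F] --> b ->
  A x *m B x @[x --> F] --> a *m b.
Proof.
move=> Aa Bb; apply: cvg_mx => i j; rewrite mxE; under eq_cvg do rewrite mxE.
apply: cvg_big => [|k _]; first exact: add_continuous.
exact: (cvgM (cvg_mx_coord Aa) (cvg_mx_coord Bb)).
Qed.

Lemma cvg_trmx m n (A : T -> 'M[K]_(m, n)) (a : 'M[K]_(m, n)) :
  A x @[x --> F] --> a -> (A x)^T @[x --> F] --> a^T.
Proof.
move=> Aa; apply: cvg_mx => i j; rewrite mxE; under eq_cvg do rewrite mxE.
exact: (cvg_mx_coord Aa).
Qed.

Lemma cvg_inner m n (A B : T -> 'M[K]_(m, n)) (a b : 'M[K]_(m, n)) :
  A x @[x --> F] --> a -> B x @[x --> F] --> b ->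
  inner (A x) (B x) @[x --> F] --> inner a b.
Proof.
move=> Aa Bb; rewrite inner_delta; under eq_cvg do rewrite inner_delta.
apply: cvg_big => [|i _]; first exact: add_continuous.
apply: cvg_big => [|j _]; first exact: add_continuous.
exact: (cvgM (cvg_mx_coord Aa) (cvg_mx_coord Bb)).
Qed.

Lemma cvg_det n (A : T -> 'M[K]_n) (a : 'M[K]_n) :
  A x @[x --> F] --> a -> \det (A x) @[x --> F] --> \det a.
Proof.
move=> Aa; apply: cvg_big => [|s _]; first exact: add_continuous.
apply: cvgM; first exact: cvg_cst.
apply: cvg_big => [|i _]; first exact: mul_continuous.
exact: (cvg_mx_coord Aa).
Qed.

End MatrixLimits.

Section TangentCone.
Context {K : realType}.

Lemma tangent_coneZ m n (S : set 'M[K]_(m, n)) x v (t : K) : 0 < t ->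
  tangent_cone S x v -> tangent_cone S x (t *: v).
Proof.
move=> t0 [z [tau [Sz tau0 tau_cvg v_cvg]]].
exists z, (fun k => t^-1 * tau k); split => //.
- by move=> k; rewrite mulr_gt0 ?invr_gt0.
- by rewrite -(mulr0 t^-1); apply: cvgM => //; exact: cvg_cst.
under eq_cvg do rewrite invfM invrK -scalerA.
exact: cvgZl_tmp.
Qed.

(** Comparing [P] with [t *: P] for [0 < t < 1] gives [(1 + t) |P|^2 <= 2 <v, P>]; the claim is the
    limit case [t = 1]. *)
Lemma is_proj_cone m n (C : set 'M[K]_(m, n)) v P :
  (forall t x, 0 < t -> C x -> C (t *: x)) -> is_proj C v P ->
  inner P P <= inner v P.
Proof.
move=> CZ [CP Pmin]; set a := inner P P; set b := inner v P.
have a0 : 0 <= a by exact: inner_ge0.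
have E t : 0 < t -> t < 1 -> (1 + t) * a <= 2 * b.
  move=> t0 t1; have := Pmin _ (CZ _ _ t0 CP).
  rewrite /fnorm ler_sqrt ?inner_ge0 //.
  rewrite !(innerDl, innerDr, innerNl, innerNr, innerZl, innerZr).
  rewrite (innerC P v) -/a -/b => H.
  have t1' : 0 < 1 - t by rewrite subr_gt0.
  rewrite -(ler_pM2l t1'); nra.
rewrite leNgt; apply/negP => ba; have a_gt0 : 0 < a.
  rewrite lt_neqAle a0 andbT eq_sym; apply/eqP => a_eq0.
  have h0 : 0 < 2^-1 :> K by lra.
  have h1 : 2^-1 < 1 :> K by lra.
  by have := E _ h0 h1; rewrite a_eq0 mulr0; lra.
have [b0|b0] := ltP b 0.
  have h0 : 0 < 2^-1 :> K by lra.
  have h1 : 2^-1 < 1 :> K by lra.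
  by have := E _ h0 h1; lra.
(* When [0 <= b < a], this [t] is close enough to [1] to contradict [E]. *)
have t_gt0 : 0 < (a + b) / (2 * a) by apply: divr_gt0; lra.
have t_lt1 : (a + b) / (2 * a) < 1 by rewrite ltr_pdivrMr; lra.
have := E _ t_gt0 t_lt1.
have -> : (1 + (a + b) / (2 * a)) * a = (3 * a + b) / 2 by field; rewrite gt_eqF.
lra.
Qed.

Lemma is_proj_cone_fnorm m n (C : set 'M[K]_(m, n)) v P :
  (forall t x, 0 < t -> C x -> C (t *: x)) -> is_proj C v P ->
  fnorm P <= fnorm v.
Proof.
move=> CZ /(is_proj_cone CZ) Pv.
have [P0|P0] := leP (fnorm P) 0; first exact: le_trans P0 (fnorm_ge0 _).
rewrite -(ler_pM2r P0) -expr2 fnorm_sqr.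
exact: le_trans Pv (inner_le_fnorm _ _).
Qed.

(* If [a^T L = 0] and [R^T b = 0], then the [(r+1) x (r+1)] minor of [z_k] along
   the columns of [(L, a)] and [(R, b)] vanishes. Dividing its last row by
   [tau_k] and passing to the limit leaves a block triangular matrix. *)
Lemma tangent_cone_rank_orth m n r (L : 'M[K]_(m, r)) (R : 'M[K]_(n, r))
    (v : 'M[K]_(m, n)) (a : 'cV[K]_m) (b : 'cV[K]_n) :
  L^T *m L \in unitmx -> R^T *m R \in unitmx ->
  a^T *m L = 0 -> R^T *m b = 0 ->
  tangent_cone (@rank_le K m n r) (L *m R^T) v -> a^T *m v *m b = 0.
Proof.
move=> LLu RRu aL Rb [z [tau [rz tau0 tau_cvg v_cvg]]].
set X := L *m R^T in v_cvg; pose y k := (tau k)^-1 *: (z k - X).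
have zE k : z k = X + tau k *: y k.
  by rewrite /y scalerA divff ?gt_eqF // scale1r addrC subrK.
have z_cvg : z k @[k --> \oo] --> X.
  under eq_cvg do rewrite zE.
  have : (X + tau k *: y k) @[k --> \oo] --> X + 0 *: v.
    by apply: cvgD; [exact: cvg_cst|exact: cvgZ].
  by rewrite scale0r addr0.
pose P1 := col_mx L^T (0 : 'M[K]_(1, m)).
pose P2 := col_mx (0 : 'M[K]_(r, m)) a^T.
pose Q := row_mx R b.
(* [G k] is the minor with its last row already divided by [tau k]: since [a^T X = 0], that row only
   sees [y k]. *)
pose G k := P1 *m z k *m Q + P2 *m y k *m Q.
have aX : a^T *m X = 0 by rewrite mulmxA aL mul0mx.
have detG k : \det (G k) = 0.
  have GE : block_mx (1%:M : 'M[K]_r) 0 0 ((tau k)%:M : 'M[K]_1) *m G k =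
    col_mx L^T a^T *m z k *m Q.
    rewrite mulmxDr !mulmxA !mul_block_col !mul1mx !mul0mx !mulmx0 !add0r !addr0.
    rewrite !mul_col_mx add_col_mx !mul0mx !addr0 add0r.
    suff -> : a^T *m z k = (tau k)%:M *m a^T *m y k by [].
    by rewrite mul_scalar_mx zE mulmxDr aX add0r -scalemxAr -!scalemxAl.
  have : \det (col_mx L^T a^T *m z k *m Q) = 0.
    apply/eqP; apply: contraTT (rz k); rewrite -unitfE -unitmxE => Gu.
    rewrite /rank_le /= -ltnNge -[r.+1]addn1 -(mxrank_unit Gu).
    exact: leq_trans (mxrankM_maxl _ _) (mxrankM_maxr _ _).
  rewrite -GE det_mulmx det_ublock det1 det_scalar1 mul1r => /eqP.
  by rewrite mulf_eq0 gt_eqF //= => /eqP.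
have G_cvg : \det (G k) @[k --> \oo] -->
    \det (P1 *m X *m Q + P2 *m v *m Q).
  apply: cvg_det; apply: cvgD; apply: cvg_mulmx; try exact: cvg_cst.
    by apply: cvg_mulmx => //; exact: cvg_cst.
  by apply: cvg_mulmx => //; exact: cvg_cst.
have : \det (P1 *m X *m Q + P2 *m v *m Q) = 0.
  have G0 : \det (G k) @[k --> \oo] --> (0 : K).
    by under eq_cvg do rewrite detG; exact: cvg_cst.
  exact: (cvg_unique _ G_cvg G0).
(* [R^T b = 0] kills the upper right block, so the determinant is the product of two nonzero Gram
   determinants and [a^T v b]. *)
have -> : P1 *m X *m Q + P2 *m v *m Q =
  block_mx ((L^T *m L) *m (R^T *m R)) 0 (a^T *m v *m R) (a^T *m v *m b).
  rewrite /P1 /P2 /Q !mul_col_mx add_col_mx !mul0mx addr0 add0r.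
  rewrite !mul_mx_row -[LHS]/(block_mx _ _ _ _).
  by rewrite /X !mulmxA -(mulmxA _ R^T b) Rb mulmx0.
rewrite det_lblock det_mulmx det_mx11 => /eqP.
rewrite !mulf_eq0 => /orP[/orP[]|]; last first.
- by move=> /eqP avb; apply/matrixP => i j; rewrite !ord1 avb mxE.
- by move: RRu; rewrite unitmxE unitfE => /negPf->.
by move: LLu; rewrite unitmxE unitfE => /negPf->.
Qed.

(** [PL] and [PR] project orthogonally onto the complements of the column spaces of [L] and [R].
    Their rows and columns serve as test vectors in [tangent_cone_rank_orth], whence [PL v PR = 0];
    the remaining parts of [v] have the stated form. *)
Lemma tangent_cone_rankP m n r (L : 'M[K]_(m, r)) (R : 'M[K]_(n, r))
    (v : 'M[K]_(m, n)) :
  L^T *m L \in unitmx -> R^T *m R \in unitmx ->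
  tangent_cone (@rank_le K m n r) (L *m R^T) v ->
  exists A B, v = A *m R^T + L *m B^T /\ L^T *m A = 0.
Proof.
move=> LLu RRu vT.
pose PL := 1%:M - L *m invmx (L^T *m L) *m L^T.
pose PR := 1%:M - R *m invmx (R^T *m R) *m R^T.
have PLL : PL *m L = 0.
  by rewrite mulmxBl mul1mx -!mulmxA mulVmx // mulmx1 subrr.
have LPL : L^T *m PL = 0.
  by rewrite mulmxBr mulmx1 !mulmxA mulmxV // mul1mx subrr.
have RPR : R^T *m PR = 0.
  by rewrite mulmxBr mulmx1 !mulmxA mulmxV // mul1mx subrr.
have PvP : PL *m v *m PR = 0.
  apply/matrixP => i j; rewrite [RHS]mxE.
  have := @tangent_cone_rank_orth _ _ _ L R v (row i PL)^T (col j PR) LLu RRu.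
  rewrite trmxK -row_mul PLL row0 colE mulmxA RPR mul0mx => /(_ erefl erefl vT).
  rewrite -row_mul mulmxA -row_mul -colE => /matrixP/(_ 0 0).
  by rewrite [LHS]mxE [LHS]mxE [RHS]mxE.
exists (PL *m v *m R *m invmx (R^T *m R)), (v^T *m L *m (invmx (L^T *m L))^T).
split; last by rewrite !mulmxA LPL !mul0mx.
rewrite !trmx_mul !trmxK.
have -> : PL *m v *m R *m invmx (R^T *m R) *m R^T = PL *m v - PL *m v *m PR.
  by rewrite [in RHS]/PR mulmxBr mulmx1 opprB addrC subrK !mulmxA.
by rewrite PvP subr0 /PL mulmxBl mul1mx !mulmxA subrK.
Qed.

End TangentCone.

(** * Second derivatives *)

Section MatrixDiff.
Context {K : realType}.

Lemma fnormZ m n a (A : 'M[K]_(m, n)) : fnorm (a *: A) = `|a| * fnorm A.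
Proof.
by rewrite /fnorm innerZl innerZr mulrA -expr2 sqrtrM ?sqr_ge0 // sqrtr_sqr.
Qed.

Lemma inner_delta_mx m n (A : 'M[K]_(m, n)) i j : inner A (delta_mx i j) = A i j.
Proof.
rewrite inner_delta (bigD1 i) //= (bigD1 j) //= mxE !eqxx mulr1.
rewrite !big1 ?addr0 // => [k ki|k kj].
  by rewrite big1 // => l _; rewrite mxE (negPf ki) mulr0.
by rewrite mxE (negPf kj) andbF mulr0.
Qed.

Lemma is_diff_linear (V W : normedModType K) (f : {linear V -> W}) x :
  continuous f -> is_diff x f f.
Proof.
move=> fc; apply: DiffDef; first exact: linear_differentiable.
exact: diff_lin.
Qed.

Lemma is_diff_mulmx (V : normedModType K) m n p (F dF : V -> 'M[K]_(m, n))
    (G dG : V -> 'M[K]_(n, p)) x :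
  is_diff x F dF -> is_diff x G dG ->
  is_diff x (fun y => F y *m G y) (fun v => F x *m dG v + dF v *m G x).
Proof.
move=> dFx dGx.
have mc : continuous (fun q : 'M[K]_(m, n) * 'M[K]_(n, p) => q.1 *m q.2).
  by move=> q; apply: cvg_mulmx; [exact: cvg_fst|exact: cvg_snd].
have md : is_diff (F x, G x) (fun q : 'M[K]_(m, n) * 'M[K]_(n, p) => q.1 *m q.2)
    (fun q => F x *m q.2 + q.1 *m G x).
  apply: DiffDef; first exact: (@differentiable_bilin _ _ _ _ (@mulmx K m n p)).
  by rewrite (@diff_bilin _ _ _ _ (@mulmx K m n p)).
exact: (is_diff_comp (is_diff_pair dFx dGx) md).
Qed.

Lemma is_diff_trmx (V : normedModType K) m n (F dF : V -> 'M[K]_(m, n)) x :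
  is_diff x F dF -> is_diff x (fun y => (F y)^T) (fun v => (dF v)^T).
Proof.
move=> dFx; have tc : continuous (@trmx K m n).
  by move=> A; apply: (@cvg_trmx K _ (nbhs (A : 'M[K]_(m, n))) _ m n id).
exact: (is_diff_comp dFx (is_diff_linear (F x) tc)).
Qed.

Lemma is_diff_innerl (V : normedModType K) m n (F dF : V -> 'M[K]_(m, n)) U x :
  is_diff x F dF -> is_diff x (fun y => inner (F y) U) (fun v => inner (dF v) U).
Proof.
move=> dFx.
have il : scalar (fun A : 'M[K]_(m, n) => inner A U).
  by move=> a A B; rewrite innerDl innerZl.
pose I : {linear 'M[K]_(m, n) -> K^o} :=
  HB.pack (fun A : 'M[K]_(m, n) => inner A U) (GRing.isLinear.Build _ _ _ _ _ il).
have Ic : continuous (I : 'M[K]_(m, n) -> K).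
  move=> A.
  apply: (@cvg_inner K _ (nbhs (A : 'M[K]_(m, n))) _ m n id (cst U)) => //.
  exact: cvg_cst.
exact: (is_diff_comp dFx (is_diff_linear (F x) Ic)).
Qed.

Lemma is_derive_line (V W : normedModType K) (F : V -> W) Y U (s : K) :
  differentiable F (Y + s *: U) ->
  is_derive s 1 (fun s => F (Y + s *: U)) ('d F (Y + s *: U) U).
Proof.
move=> dF.
have dl : is_diff s (fun s : K => Y + s *: U) (fun s => s *: U).
  apply: (@is_diff_eq _ _ _ _ _ _ _ (is_diffD (is_diff_cst Y s) (is_diff_scalel s U))).
  by apply/funext => z; rewrite /= !fctE add0r.
have dc := is_diff_comp dl (differentiableP dF).
apply: DeriveDef; first exact/diff_derivable/(@ex_diff _ _ _ _ _ _ _ dc).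
rewrite deriveE; last exact: (@ex_diff _ _ _ _ _ _ _ dc).
by rewrite (@diff_val _ _ _ _ _ _ _ dc) /= scale1r.
Qed.

End MatrixDiff.

Section SecondDerivative.
Context {K : realType} (m n : nat) (f : 'M[K]_(m, n) -> K).

(** The mean value theorem is applied to [h] along [U], then to [k] along [V]. The left side is
    symmetric in [U] and [V], which [hessian_sym] exploits. *)
Lemma second_difference X U V (t : K) : C2 f -> 0 < t ->
  exists a b, [/\ 0 < a < t, 0 < b < t &
    f (X + t *: U + t *: V) - f (X + t *: U) - (f (X + t *: V) - f X) =
    t ^+ 2 * inner ('d (grad f) (X + a *: U + b *: V) V) U].
Proof.
move=> [df dgf _] t0.
have line_cont (F : K -> K) (dF : K -> K) :
    (forall s : K, is_derive s 1 F (dF s)) -> {within `[0, t], continuous F}.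
  move=> Fd; apply: continuous_subspaceT => s; apply: differentiable_continuous.
  exact/derivable1_diffP.
pose h (s : K) := f (X + t *: V + s *: U) - f (X + s *: U).
have hd (s : K) : is_derive s 1 h
    (inner (grad f (X + t *: V + s *: U)) U - inner (grad f (X + s *: U)) U).
  rewrite -!grad_innerE //.
  exact: (is_deriveB (is_derive_line (df _)) (is_derive_line (df _))).
have [a] := MVT t0 (fun s _ => hd s) (line_cont _ _ hd).
rewrite in_itv /= => /andP[a0 at_] hE.
pose k (s : K) := inner (grad f (X + a *: U + s *: V)) U.
have kd (s : K) : is_derive s 1 k (inner ('d (grad f) (X + a *: U + s *: V) V) U).
  have dk := is_diff_innerl U (differentiableP (dgf (X + a *: U + s *: V))).
  have := is_derive_line (@ex_diff _ _ _ _ _ _ _ dk).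
  by rewrite (@diff_val _ _ _ _ _ _ _ dk).
have [b] := MVT t0 (fun s _ => kd s) (line_cont _ _ kd).
rewrite in_itv /= => /andP[b0 bt] kE.
exists a, b; rewrite a0 at_ b0 bt; split => //.
move: hE kE; rewrite /h /k !scale0r !addr0 !subr0.
rewrite (addrAC X (t *: V)) (addrAC X (t *: V)) => hE kE.
by rewrite hE kE expr2; ring.
Qed.

(** Puts continuity at [X] in the form in which the intermediate points of [second_difference]
    occur. *)
Lemma near_corner (E : 'M[K]_(m, n) -> K) X U V (e : K) : continuous E -> 0 < e ->
  exists2 d, 0 < d & forall a b, 0 < a < d -> 0 < b < d ->
    `|E X - E (X + a *: U + b *: V)| < e.
Proof.
move=> Ec e0; pose Q (p : K * K) := X + p.1 *: U + p.2 *: V.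
have Qc : E (Q p) @[p --> (0, 0)] --> E (Q (0, 0)).
  apply: (@continuous_comp _ _ _ Q E); last exact: Ec.
  apply: cvgD; last by apply: cvgZr_tmp; exact: cvg_snd.
  by apply: cvgD; [exact: cvg_cst|apply: cvgZr_tmp; exact: cvg_fst].
move/cvgrPdist_lt: Qc => /(_ e e0) /nbhs_ballP[d /= d0 dE].
exists d => // a b /andP[a0 ad] /andP[b0 bd].
have := dE (a, b); rewrite /Q /= !scale0r !addr0; apply.
by split; rewrite /ball /= sub0r normrN gtr0_norm.
Qed.

(** Schwarz's theorem. If the two sides were at distance [e > 0], then for small [t] each would be
    within [e / 2] of the second difference divided by [t ^+ 2], which is the same for both orders
    of [U] and [V]. *)
Lemma hessian_sym X U V : C2 f ->
  inner ('d (grad f) X U) V = inner ('d (grad f) X V) U.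
Proof.
move=> fC2; have [_ _ Hc] := fC2.
pose E A B Y := inner ('d (grad f) Y A) B.
have Ec A B : continuous (E A B).
  by move=> Y; exact: (cvg_inner (Hc A Y) (cvg_cst B)).
apply/eqP; rewrite -subr_eq0 -normr_eq0 -[_ == 0]negbK normr_eq0.
apply/negP => neq0; set e := `|inner ('d (grad f) X U) V - inner ('d (grad f) X V) U|.
have e0 : 0 < e / 2 by rewrite divr_gt0 // normr_gt0.
have [d1 d1_gt0 d1E] := near_corner X U V (Ec V U) e0.
have [d2 d2_gt0 d2E] := near_corner X V U (Ec U V) e0.
pose t := Num.min d1 d2.
have t0 : 0 < t by rewrite lt_min d1_gt0.
have [a [b [/andP[a0 at_] /andP[b0 bt] abE]]] := second_difference X U V fC2 t0.
have [c [d [/andP[c0 ct] /andP[d0 dt] cdE]]] := second_difference X V U fC2 t0.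
have t1 : t <= d1 by rewrite ge_min lexx.
have t2 : t <= d2 by rewrite ge_min lexx orbT.
have := d1E a b; rewrite a0 b0 !(lt_le_trans _ t1) // => /(_ isT isT).
have := d2E c d; rewrite c0 d0 !(lt_le_trans _ t2) // => /(_ isT isT).
have -> : E U V (X + c *: V + d *: U) = E V U (X + a *: U + b *: V).
  apply: (mulfI (lt0r_neq0 (exprn_gt0 2 t0))); rewrite -abE -cdE.
  by rewrite (addrAC X); ring.
rewrite /E => h1 h2; have := ltrD h1 h2; rewrite -splitr ltNge /e => /negP; apply.
by rewrite [Y in _ <= _ + Y]distrC; exact: ler_distD.
Qed.

(** The difference quotients of [grad f] along [Z] obey the bound, by Cauchy-Schwarz and the
    Lipschitz condition, and it passes to their limit. *)
Lemma hessian_le_lipschitz (Lf : K) X Z : C2 f -> lipschitz_grad f Lf ->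
  inner ('d (grad f) X Z) Z <= Lf * inner Z Z.
Proof.
move=> [_ dgf _] f_lip.
have := @diff_derivable _ _ _ _ _ Z (dgf X); rewrite /derivable -deriveE // /derive.
set q := fun h : K => _; move=> q_cvg.
have : inner (q h) Z @[h --> 0^'] --> inner (lim (q h @[h --> 0^'])) Z.
  exact: (cvg_inner q_cvg (cvg_cst Z)).
move=> /cvgr_to_le; apply; near=> h.
have h0 : h != 0 by near: h; exact: nbhs_dnbhs_neq.
apply: le_trans (inner_le_fnorm _ _) _.
rewrite -fnorm_sqr expr2 mulrA ler_wpM2r ?fnorm_ge0 // fnormZ.
rewrite normfV ler_pdivrMl ?normr_gt0 // /= mulrCA -fnormZ.
by have := f_lip (h *: Z + X) X; rewrite addrK.
Unshelve. all: by end_near. Qed.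

End SecondDerivative.

(** * Gradient and Hessian of the lifted function *)

Section Factorization.
Context {K : realType} (m n r : nat) (f : 'M[K]_(m, n) -> K).

Let fact (y : 'M[K]_(m, r) * 'M[K]_(n, r)) : 'M[K]_(m, n) := y.1 *m y.2^T.

Lemma is_diff_fact (y : 'M[K]_(m, r) * 'M[K]_(n, r)) :
  is_diff y fact (fun v : 'M[K]_(m, r) * 'M[K]_(n, r) =>
    y.1 *m v.2^T + v.1 *m y.2^T).
Proof.
have fstd : is_diff y fst fst by apply: is_diff_linear => z; exact: cvg_fst.
have sndd : is_diff y snd snd by apply: is_diff_linear => z; exact: cvg_snd.
exact: (is_diff_mulmx fstd (is_diff_trmx sndd)).
Qed.

Lemma grad2_lift_LR (y : 'M[K]_(m, r) * 'M[K]_(n, r)) : (forall X, differentiable f X) ->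
  grad2 (lift_LR f) y =
  (grad f (y.1 *m y.2^T) *m y.2, (grad f (y.1 *m y.2^T))^T *m y.1).
Proof.
move=> df; have dg := is_diff_comp (is_diff_fact y) (differentiableP (df (fact y))).
have dgE := @ex_diff _ _ _ _ _ _ _ dg.
have DE v : 'D_v (lift_LR f) y =
    inner (grad f (fact y)) (y.1 *m v.2^T + v.1 *m y.2^T).
  rewrite deriveE // -[lift_LR f]/(f \o fact) (@diff_val _ _ _ _ _ _ _ dg) /=.
  by rewrite grad_innerE.
congr (_, _); apply/matrixP => i j; rewrite mxE DE /=.
  rewrite trmx0 mulmx0 add0r innerC inner_mulmxr trmxK innerC.
  by rewrite inner_delta_mx.
rewrite mul0mx addr0 innerC inner_mulmxl -inner_trmx trmxK innerC.
by rewrite inner_delta_mx trmx_mul trmxK.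
Qed.

Lemma hess2_lift_LR (y v : 'M[K]_(m, r) * 'M[K]_(n, r)) : C2 f ->
  let G := grad f (y.1 *m y.2^T) in
  let H := 'd (grad f) (y.1 *m y.2^T) (y.1 *m v.2^T + v.1 *m y.2^T) in
  hess2 (lift_LR f) y v = (G *m v.2 + H *m y.2, G^T *m v.1 + H^T *m y.1).
Proof.
move=> [df dgf _] G H; rewrite /hess2.
have -> : grad2 (lift_LR f) =
    (fun y => ((grad f \o fact) y *m y.2, ((grad f \o fact) y)^T *m y.1)).
  by apply/funext => z; rewrite grad2_lift_LR.
have fstd : is_diff y fst fst by apply: is_diff_linear => z; exact: cvg_fst.
have sndd : is_diff y snd snd by apply: is_diff_linear => z; exact: cvg_snd.
have dG := is_diff_comp (is_diff_fact y) (differentiableP (dgf (fact y))).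
have d2 := is_diff_pair (is_diff_mulmx dG sndd)
  (is_diff_mulmx (is_diff_trmx dG) fstd).
by rewrite (@diff_val _ _ _ _ _ _ _ d2).
Qed.

(** The first term is the Hessian of [f] along first-order variations of [L R^T], the second pairs
    the gradient of [f] with the second-order variation. In this shape, symmetry in [v] and [w]
    reduces to [hessian_sym]. *)
Lemma inner2_hess2_lift_LR (y v w : 'M[K]_(m, r) * 'M[K]_(n, r)) : C2 f ->
  inner2 (hess2 (lift_LR f) y v) w =
  inner ('d (grad f) (y.1 *m y.2^T) (y.1 *m v.2^T + v.1 *m y.2^T))
    (y.1 *m w.2^T + w.1 *m y.2^T)
  + inner (grad f (y.1 *m y.2^T)) (v.1 *m w.2^T + w.1 *m v.2^T).
Proof.
move=> fC2; rewrite hess2_lift_LR //; set G := grad f _; set H := 'd _ _ _.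
have E (A : 'M[K]_(m, n)) (B : 'M[K]_(m, r)) (C : 'M[K]_(n, r)) :
    inner (A^T *m B) C = inner A (B *m C^T).
  by rewrite inner_mulmxl trmxK innerC inner_mulmxr innerC.
by rewrite /inner2 /= !innerDl !E !inner_mulmxr !innerDr; ring.
Qed.

End Factorization.

(** * Balanced critical points *)

Section BalancedCritical.
Context {K : realType}.

Lemma inner_rowE m n (A B : 'M[K]_(m, n)) :
  inner A B = \sum_i inner (row i A) (row i B).
Proof.
rewrite inner_delta; apply: eq_bigr => i _; rewrite inner_delta big_ord1.
by apply: eq_bigr => j _; rewrite !mxE.
Qed.

Lemma inner_outer m n (u u' : 'cV[K]_m) (v v' : 'rV[K]_n) :
  inner (u *m v) (u' *m v') = inner u u' * inner v v'.
Proof.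
rewrite inner_mulmxr -mulmxA [v' *m v^T]mx11_scalar mul_mx_scalar innerZr.
by rewrite rV_dotE mulrC (innerC v').
Qed.

(** Positive dimensions provide a matrix at positive distance from [0], on which the Lipschitz
    inequality is tested. *)
Lemma lipschitz_grad_ge0 m n (f : 'M[K]_(m, n) -> K) (Lf : K) :
  (0 < m)%N -> (0 < n)%N -> lipschitz_grad f Lf -> 0 <= Lf.
Proof.
move=> m0 n0 /(_ (delta_mx (Ordinal m0) (Ordinal n0)) 0); rewrite subr0.
move/(le_trans (fnorm_ge0 _)); rewrite pmulr_lge0 // sqrtr_gt0.
by rewrite inner_delta_mx mxE !eqxx.
Qed.

(* Second-order criticality along [(u w, - v w)], where [w] is an eigenvector of
   [R^T R] for its smallest eigenvalue [sigma r X]. *)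
Lemma grad_outer_le m n r (f : 'M[K]_(m, n) -> K) (Lf eps2 : K)
    (L : 'M[K]_(m, r)) (R : 'M[K]_(n, r)) (u : 'cV[K]_m) (v : 'cV[K]_n) :
  (1 <= r)%N -> (r <= minn m n)%N -> C2 f -> lipschitz_grad f Lf ->
  - eps2 <= lambda_min (hess2 (lift_LR f) (L, R)) -> L^T *m L = R^T *m R ->
  2 * inner (grad f (L *m R^T)) (u *m v^T) <=
  (eps2 + 2 * Lf * sigma r (L *m R^T)) * (inner u u + inner v v).
Proof.
move=> r1 r_le fC2 f_lip lam LR.
have m0 : (0 < m)%N by rewrite (leq_trans r1) // (leq_trans r_le) // geq_minl.
have n0 : (0 < n)%N by rewrite (leq_trans r1) // (leq_trans r_le) // geq_minr.
have Lf0 := lipschitz_grad_ge0 m0 n0 f_lip.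
have [_ [w w0 wM] _] := sigma_balanced r1 r_le LR.
set X := L *m R^T; set s := sigma r X in wM *; set G := grad f X.
have ww0 : 0 < inner w w by rewrite lt_neqAle eq_sym inner_eq0 w0 inner_ge0.
have Rw : inner (R *m w^T) (R *m w^T) = s * inner w w.
  by rewrite -inner_gram wM innerZl.
have Lw : inner (L *m w^T) (L *m w^T) = s * inner w w.
  by rewrite -inner_gram LR wM innerZl.
(* The minus sign makes [z.1 *m z.2^T] a negative multiple of [u v^T], so that the lower bound on
   the Hessian becomes an upper bound on the pairing with [G]. *)
pose z := (u *m w, - (v *m w)).
pose a := u *m (R *m w^T)^T; pose b := L *m w^T *m v^T.
have ZE : L *m z.2^T + z.1 *m R^T = a - b.
  rewrite /z /a /b /= linearN /= mulmxN trmx_mul mulmxA addrC.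
  by rewrite [(R *m _)^T]trmx_mul trmxK mulmxA.
have aa : inner a a = inner u u * (s * inner w w).
  by rewrite /a inner_outer inner_trmx Rw.
have bb : inner b b = s * inner w w * inner v v.
  by rewrite /b inner_outer inner_trmx Lw.
have ZZ : inner (a - b) (a - b) <= 2 * (s * inner w w * (inner u u + inner v v)).
  (* Adding [|a + b|^2 >= 0] gives [|a - b|^2 <= 2 |a|^2 + 2 |b|^2]. *)
  have := inner_ge0 (a + b).
  rewrite !(innerDl, innerDr, innerNl, innerNr) aa bb (innerC b a); lra.
have zz : inner2 z z = inner w w * (inner u u + inner v v).
  by rewrite /inner2 /= innerNl innerNr opprK !inner_outer; ring.
have zG : z.1 *m z.2^T = - inner w w *: (u *m v^T).
  rewrite /z /= linearN /= mulmxN trmx_mul mulmxA -(mulmxA u).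
  by rewrite [w *m w^T]mx11_scalar rV_dotE mul_mx_scalar -scalemxAl scaleNr.
have N0 : (0 < m * r + n * r)%N by rewrite addn_gt0 muln_gt0 m0 r1.
have := @lambda_min_le K m r n r ('d (grad2 (lift_LR f)) (L, R)) N0.
rewrite -[X in lambda_min X]/(hess2 (lift_LR f) (L, R)) => lam_le.
have : - eps2 * inner2 z z <= inner2 (hess2 (lift_LR f) (L, R) z) z.
  apply: le_trans (lam_le _ z); first by rewrite ler_wpM2r // addr_ge0 ?inner_ge0.
  move=> y y'; rewrite -![X in inner2 X _]/(hess2 (lift_LR f) (L, R) _).
  rewrite !inner2_hess2_lift_LR //= hessian_sym //; congr (_ + inner _ _).
  exact: addrC.
rewrite inner2_hess2_lift_LR //= -/X -/G.
have -> : L *m (- (v *m w))^T + u *m w *m R^T = a - b by exact: ZE.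
have -> : u *m w *m (- (v *m w))^T = - inner w w *: (u *m v^T) by exact: zG.
rewrite [inner G _]innerDr innerZr zz => h2.
have h1 := hessian_le_lipschitz X (a - b) fC2 f_lip.
have h3 : Lf * inner (a - b) (a - b) <=
    Lf * (2 * (s * inner w w * (inner u u + inner v v))) by rewrite ler_wpM2l.
rewrite -(ler_pM2l ww0); lra.
Qed.

(** The bilinear bound of [grad_outer_le] becomes a bound on [|G x^T|^2] by choosing [u]
    proportional to [G x^T] and [v = x^T]. *)
Lemma grad_form_le m n r (f : 'M[K]_(m, n) -> K) (Lf eps2 : K)
    (L : 'M[K]_(m, r)) (R : 'M[K]_(n, r)) :
  (1 <= r)%N -> (r <= minn m n)%N -> C2 f -> lipschitz_grad f Lf ->
  - eps2 <= lambda_min (hess2 (lift_LR f) (L, R)) -> L^T *m L = R^T *m R ->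
  let b := eps2 + 2 * Lf * sigma r (L *m R^T) in
  let G := grad f (L *m R^T) in
  0 <= b -> forall x : 'rV[K]_n, inner (x *m (G^T *m G)) x <= b ^+ 2 * inner x x.
Proof.
move=> r1 r_le fC2 f_lip lam LR b G b0 x.
have E c : 2 * c * inner (G *m x^T) (G *m x^T) <=
    b * (c ^+ 2 * inner (G *m x^T) (G *m x^T) + inner x x).
  have := @grad_outer_le _ _ _ f Lf eps2 L R (c *: (G *m x^T)) x^T.
  move=> /(_ r1 r_le fC2 f_lip lam LR); rewrite -/b -/G trmxK.
  rewrite -scalemxAl innerZr innerZl innerZr inner_trmx.
  have -> : inner G (G *m x^T *m x) = inner (G *m x^T) (G *m x^T).
    by rewrite [RHS]inner_mulmxr trmxK.
  by rewrite expr2 !mulrA.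
rewrite inner_gram; set g := inner _ _ in E *.
have [b_gt0|] := ltP 0 b; last first.
  move=> b_le0; have b_eq0 : b = 0 by apply/eqP; rewrite eq_le b_le0 b0.
  by have := E 1; rewrite b_eq0 expr0n /=; lra.
(* This [c] maximizes [2 c - b c^2], the net coefficient of [g]. *)
have := E b^-1.
have -> : b * (b^-1 ^+ 2 * g + inner x x) = b^-1 * (g + b ^+ 2 * inner x x).
  by field; rewrite gt_eqF.
have -> : 2 * b^-1 * g = b^-1 * (2 * g) by ring.
rewrite ler_pM2l ?invr_gt0 //; lra.
Qed.

Lemma form_ge_mx m r (M : 'M[K]_r) (s : K) (A : 'M[K]_(m, r)) :
  (forall x : 'rV[K]_r, s * inner x x <= inner (x *m M) x) ->
  s * inner A A <= inner (A *m M) A.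
Proof.
move=> Ms; rewrite !inner_rowE mulr_sumr; apply: ler_sum => i _.
by rewrite row_mul.
Qed.

(** Full rank of the product makes [R^T] row free, and [x (R^T R) = 0] forces [|R x^T|^2 = 0]. *)
Lemma gram_unit m r n (L : 'M[K]_(m, r)) (R : 'M[K]_(n, r)) :
  \rank (L *m R^T) = r -> R^T *m R \in unitmx.
Proof.
move=> rX; rewrite -row_free_unit -kermx_eq0; apply/rowV0P => x /sub_kermxP xM.
have Rfree : row_free R^T.
  by rewrite /row_free eqn_leq rank_leq_row -{1}rX mxrankM_maxr.
apply: (row_free_inj Rfree); rewrite mul0mx; apply: trmx_inj.
rewrite trmx_mul trmxK trmx0; apply/eqP; rewrite -inner_eq0 -inner_gram xM.
by rewrite /inner trmx0 mul0mx linear0.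
Qed.

Lemma proj_le_eps1 m n r (f : 'M[K]_(m, n) -> K) (eps1 : K)
    (L : 'M[K]_(m, r)) (R : 'M[K]_(n, r)) (P : 'M[K]_(m, n)) :
  (1 <= r)%N -> (r <= minn m n)%N -> C2 f -> 0 <= eps1 ->
  fnorm2 (grad2 (lift_LR f) (L, R)) <= eps1 -> L^T *m L = R^T *m R ->
  \rank (L *m R^T) = r ->
  is_proj (tangent_cone (@rank_le K m n r) (L *m R^T)) (- grad f (L *m R^T)) P ->
  fnorm P <= Num.sqrt (2 / sigma r (L *m R^T)) * eps1.
Proof.
move=> r1 r_le [df _ _] eps1_ge0 g_le LR rX Pproj.
have [s_ge0 [w w0 wM] M_ge] := sigma_balanced r1 r_le LR.
set X := L *m R^T; set s := sigma r X in wM M_ge s_ge0 *; set G := grad f X.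
have Mu : R^T *m R \in unitmx := gram_unit rX.
have s_gt0 : 0 < s.
  rewrite lt_neqAle s_ge0 andbT eq_sym; apply: contraNneq w0 => s0.
  by apply/eqP; rewrite -(mulmxK Mu w) wM s0 scale0r mul0mx.
have [PT _] := Pproj.
have LLu : L^T *m L \in unitmx by rewrite LR.
have [A [C [PE LA]]] := tangent_cone_rankP LLu Mu PT.
have := is_proj_cone (fun t x t0 => tangent_coneZ t0) Pproj; rewrite -fnorm_sqr => PG.
have AR : s * inner A A <= inner (A *m R^T) (A *m R^T).
  by rewrite inner_mulmxr trmxK -mulmxA [leRHS]innerC; exact: form_ge_mx.
have CL : s * inner C C <= inner (L *m C^T) (L *m C^T).
  rewrite -(inner_trmx (L *m _)) trmx_mul trmxK inner_mulmxr trmxK -mulmxA LR.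
  rewrite [leRHS]innerC.
  exact: form_ge_mx.
have cross : inner (A *m R^T) (L *m C^T) = 0.
  by rewrite innerC inner_mulmxl mulmxA LA mul0mx /inner mulmx0 linear0.
pose N2 := inner2 (A, C) (A, C).
have PN : s * N2 <= fnorm P ^+ 2.
  rewrite fnorm_sqr PE !innerDl !innerDr (innerC (L *m _)) cross /N2 /inner2 /=; lra.
have PN1 : fnorm P ^+ 2 <= eps1 * fnorm2 (A, C).
  apply: le_trans PG _.
  have -> : inner (- G) P = inner2 (grad2 (lift_LR f) (L, R)) (- A, - C).
    rewrite grad2_lift_LR //= -/X -/G /inner2 /= PE innerDr !innerNl !innerNr.
    congr (- _ + - _); first by rewrite inner_mulmxr.
    by rewrite [RHS]inner_mulmxl trmxK [RHS]innerC [RHS]inner_mulmxr.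
  apply: le_trans (inner2_le_fnorm2 _ _) _.
  have -> : fnorm2 (- A, - C) = fnorm2 (A, C).
    by rewrite /fnorm2 /inner2 /= !innerNl !innerNr !opprK.
  by rewrite ler_wpM2r // sqrtr_ge0.
have N2_ge0 : 0 <= N2 by rewrite addr_ge0 ?inner_ge0.
have N2E : fnorm2 (A, C) ^+ 2 = N2 by rewrite sqr_sqrtr.
have P2 : fnorm P ^+ 2 <= 2 / s * eps1 ^+ 2.
  have [P0|P0] := leP (fnorm P ^+ 2) 0.
    by apply: le_trans P0 _; rewrite mulr_ge0 ?sqr_ge0 // divr_ge0.
  (* Squaring [PN1] and inserting [PN] leaves a factor [|P|^2] on both sides, which is positive here
     and cancels. *)
  have p4 : fnorm P ^+ 2 * fnorm P ^+ 2 <= eps1 ^+ 2 * N2.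
    by rewrite -expr2 -N2E -exprMn ler_sqr ?nnegrE ?(ltW P0) // mulr_ge0 ?sqrtr_ge0.
  have p5 : s * (fnorm P ^+ 2 * fnorm P ^+ 2) <= eps1 ^+ 2 * fnorm P ^+ 2.
    apply: le_trans (ler_wpM2l (sqr_ge0 eps1) PN).
    by rewrite [leRHS]mulrCA ler_pM2l.
  move: p5; rewrite mulrA ler_pM2r // => p5.
  (* The bound obtained is [s |P|^2 <= eps1^2]; the factor [2] comes in through [1 <= 2]. *)
  rewrite mulrAC ler_pdivlMr // mulrC (le_trans p5) //.
  by rewrite ler_peMl ?sqr_ge0 // ler1n.
rewrite -(ger0_norm eps1_ge0) -(sqrtr_sqr eps1) -sqrtrM ?divr_ge0 //.
by rewrite -(ger0_norm (fnorm_ge0 P)) -sqrtr_sqr ler_wsqrtr.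
Qed.

End BalancedCritical.

Unset Implicit Arguments.

Theorem theorem3p16 (K : realType) (m n r : nat)
    (r_ge1 : (1 <= r)%N) (r_le : (r <= minn m n)%N)
    (f : 'M[K]_(m, n) -> K) (Lf : K)
    (f_C2 : C2 f) (f_lip : lipschitz_grad f Lf)
    (eps1 eps2 : K) (eps1_ge0 : 0 <= eps1) (eps2_ge0 : 0 <= eps2)
    (L : 'M[K]_(m, r)) (R : 'M[K]_(n, r))
    (LR_crit : approx_2critical eps1 eps2 (lift_LR f) (L, R))
    (LR_bal : L^T *m L = R^T *m R) :
  let X : 'M[K]_(m, n) := L *m R^T in
  opnorm (grad f X) <= eps2 + 2 * Lf * sigma r X /\
  (forall P : 'M[K]_(m, n),
     is_proj (tangent_cone (@rank_le K m n r) X) (- grad f X) P ->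
     ((fnorm P)%:E <=
      Order.min
        (if (\rank X < r)%N then +oo
         else (Num.sqrt (2 / sigma r X) * eps1)%:E)
        (Num.sqrt (\rank (grad f X))%:R * (eps2 + 2 * Lf * sigma r X))%:E)%E).
Proof.
move=> X; have [g_le lam] := LR_crit.
have m0 : (0 < m)%N by rewrite (leq_trans r_ge1) // (leq_trans r_le) // geq_minl.
have n0 : (0 < n)%N by rewrite (leq_trans r_ge1) // (leq_trans r_le) // geq_minr.
have Lf0 := lipschitz_grad_ge0 m0 n0 f_lip.
have [s_ge0 _ _] := sigma_balanced r_ge1 r_le LR_bal.
have b0 : 0 <= eps2 + 2 * Lf * sigma r X by rewrite addr_ge0 ?mulr_ge0.
have Gb := grad_form_le r_ge1 r_le f_C2 f_lip lam LR_bal b0.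
split; first exact: opnorm_le.
move=> P Pproj; rewrite le_min lee_fin; apply/andP; split; last first.
  (* Projecting on a cone does not increase the norm, and [- grad f X] has the norm of
     [grad f X]. *)
  apply: le_trans (fnorm_le_rank b0 Gb).
  have := is_proj_cone_fnorm (fun t x t0 => tangent_coneZ t0) Pproj.
  by rewrite /fnorm innerNl innerNr opprK.
(* Below rank [r] the first bound is [+oo]; otherwise the rank equals [r], because [L] has [r]
   columns. *)
case: ltnP => [_|rX]; first exact: leey.
have rXE : \rank (L *m R^T) = r.
  apply/eqP; rewrite eqn_leq rX andbT.
  exact: leq_trans (mxrankM_maxl _ _) (rank_leq_col _).
rewrite lee_fin.
exact: (proj_le_eps1 r_ge1 r_le f_C2 eps1_ge0 g_le LR_bal rXE Pproj).
Qed.
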